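(* Let $r \geq 1$ be an integer and let $b > 1$ be an integer with $\gcd(2,b) = 1$ such that $2^r b^2$ is almost perfect. Then: (i) if $r = 1$, then $8/7 < I(b^2) < 4/3$, and consequently $3 \nmid b$; (ii) if $r > 1$, then $I(b^2) < 8/7$, and consequently $7 \nmid b$.
   Context: $\sigma(x)$ denotes the sum of the positive divisors of $x$, and $I(x) = \sigma(x)/x$ is the abundancy index. A positive integer $y$ is almost perfect if $\sigma(y) = 2y - 1$. *)

(* Defs.v *)
From mathcomp Require Import all_boot all_order all_algebra.

Set Implicit Arguments.
Unset Strict Implicit.
Unset Printing Implicit Defensive.

Import GRing.Theory Num.Theory.

Definition sigma (n : nat) : nat := \sum_(d <- divisors n) d.

Definition abundancy (n : nat) : rat := ((sigma n)%:R / n%:R)%R.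

(* Since [0 < y], the subtraction below is never truncated. *)
Definition almost_perfect (y : nat) : Prop :=
  0 < y /\ sigma y = 2 * y - 1.

(* Main.v *)
(** Multiplicativity of [sigma] turns almost perfection of [2^r b^2] into
    [(2^(r+1) - 1) sigma(b^2) = 2^(r+1) b^2 - 1], that is
    [I(b^2) = 2^(r+1)/(2^(r+1) - 1) - 1/((2^(r+1) - 1) b^2)].  For [r = 1] this
    is [4/3 - 1/(3 b^2)]; for [r > 1] it is below [2^(r+1)/(2^(r+1) - 1) <= 8/7].
    A prime [p] dividing [b] forces [I(b^2) >= 1 + 1/p], which excludes [p = 3],
    respectively [p = 7]. *)
Require Import Defs.
From mathcomp Require Import all_boot all_order all_algebra.
From mathcomp Require Import zify.

Import Order.TTheory GRing.Theory Num.Theory.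

(** Cancelling [gcdn d m] leaves a quotient of [d] coprime to that of [m], so Gauss's lemma applies.
    This supplies the [n]-part of a divisor of [m * n]. *)
Lemma dvdn_mul_split d m n :
  0 < d -> d %| m * n -> d %/ gcdn d m %| n.
Proof.
move=> d_gt0 d_mn.
have g_gt0 : 0 < gcdn d m by rewrite gcdn_gt0 d_gt0.
have cop : coprime (d %/ gcdn d m) (m %/ gcdn d m).
  rewrite /coprime -(eqn_pmul2r g_gt0) muln_gcdl.
  by rewrite !divnK ?dvdn_gcdl ?dvdn_gcdr ?mul1n.
rewrite -(Gauss_dvdr _ cop) -(dvdn_pmul2r g_gt0) mulnAC !divnK //.
  exact: dvdn_gcdr.
exact: dvdn_gcdl.
Qed.

Lemma perm_divisorsM m n : 0 < m -> 0 < n -> coprime m n ->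
  perm_eq (divisors (m * n)) [seq d * e | d <- divisors m, e <- divisors n].
Proof.
move=> m_gt0 n_gt0 cop_mn; have mn_gt0 : 0 < m * n by rewrite muln_gt0 m_gt0.
apply: uniq_perm (divisors_uniq _) _ _ => [|d].
  apply: allpairs_uniq (divisors_uniq _) (divisors_uniq _) _.
  move=> _ _ /allpairsP[[d e] /= [+ + ->]] /allpairsP[[d' e'] /= [+ + ->]].
  rewrite -!dvdn_divisors // => dm en d'm e'n eq_de.
  (* Injectivity: by coprimality, both factors can be read off the product by taking gcds with [m]
     and [n]. *)
  have coprime_dvd d1 e1 : d1 %| m -> e1 %| n ->
      gcdn m (d1 * e1) = d1 /\ gcdn n (d1 * e1) = e1.
    move=> d1m e1n; split.
      rewrite Gauss_gcdl ?(coprime_dvdr e1n) //.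
      exact/gcdn_idPr.
    rewrite Gauss_gcdr; first exact/gcdn_idPr.
    by rewrite coprime_sym (coprime_dvdl d1m).
  have [eq_d eq_e] := coprime_dvd _ _ dm en.
  have [eq_d' eq_e'] := coprime_dvd _ _ d'm e'n.
  by move: eq_d eq_e; rewrite [d * e]eq_de eq_d' eq_e' => -> ->.
rewrite -dvdn_divisors //; apply/idP/allpairsP => [d_mn | [[d1 e1] /= [+ + ->]]].
  have d_gt0 := dvdn_gt0 mn_gt0 d_mn.
  (* Surjectivity: split [d] into its [m]-part and the cofactor. *)
  exists (gcdn d m, d %/ gcdn d m); rewrite /= -!dvdn_divisors //.
  by rewrite dvdn_gcdr dvdn_mul_split // mulnC divnK ?dvdn_gcdl.
by rewrite -!dvdn_divisors //; exact: dvdn_mul.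
Qed.

Lemma sigmaM m n : 0 < m -> 0 < n -> coprime m n ->
  sigma (m * n) = sigma m * sigma n.
Proof.
move=> m_gt0 n_gt0 cop_mn; rewrite /sigma (perm_big _ (perm_divisorsM _ _ _ _ _)) //.
rewrite -(map_allpairs (fun x => x.1 * x.2) pair) big_map big_allpairs big_distrl /=.
by apply: eq_bigr => d _; rewrite big_distrr.
Qed.

Lemma sigma_pfactor p k : prime p -> sigma (p ^ k) = \sum_(i < k.+1) p ^ i.
Proof.
move=> p_pr; have pk_gt0 : 0 < p ^ k by rewrite expn_gt0 prime_gt0.
rewrite /sigma -(big_mkord xpredT (expn p)) -(big_map (expn p) xpredT id).
apply: perm_big; apply: uniq_perm => [||d]; first exact: divisors_uniq.
  by rewrite map_inj_uniq ?iota_uniq //; apply: expnI; exact: prime_gt1.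
rewrite -dvdn_divisors //; apply/dvdn_pfactor/mapP => // -[i].
  by move=> ik ->; exists i; rewrite // mem_index_iota.
by rewrite mem_index_iota => /= ik ->; exists i.
Qed.

(** Since [1 < p], [n] and [n %/ p] are two distinct divisors of [n]. *)
Lemma leq_sigma p n : 0 < n -> 1 < p -> p %| n -> n + n %/ p <= sigma n.
Proof.
move=> n_gt0 p_gt1 pn; rewrite /sigma (bigD1_seq n) ?divisors_id ?divisors_uniq //=.
have ltn_np : n %/ p < n by rewrite ltn_Pdiv.
rewrite (big_rem (n %/ p)) /=; last by rewrite -dvdn_divisors ?dvdn_div.
by rewrite ltn_eqF // addnA leq_addr.
Qed.

(** Clearing denominators moves the rational bounds to [nat], where [lia] and [nia] can settle
    them. *)
Lemma abundancy_lt n a c : 0 < n -> 0 < c ->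
  (abundancy n < a%:R / c%:R)%R = (c * sigma n < a * n).
Proof.
move=> n_gt0 c_gt0; rewrite /abundancy ltr_pdivrMr ?ltr0n // mulrAC.
by rewrite ltr_pdivlMr ?ltr0n // -!natrM ltr_nat mulnC.
Qed.

Lemma abundancy_gt n a c : 0 < n -> 0 < c ->
  (a%:R / c%:R < abundancy n)%R = (a * n < c * sigma n).
Proof.
move=> n_gt0 c_gt0; rewrite /abundancy ltr_pdivlMr ?ltr0n // mulrAC.
by rewrite ltr_pdivrMr ?ltr0n // -!natrM ltr_nat [sigma n * c]mulnC.
Qed.

Lemma almost_perfect_sigma_odd r m : odd m -> almost_perfect (2 ^ r * m) ->
  (2 ^ r.+1).-1 * sigma m = (2 ^ r.+1 * m).-1.
Proof.
move=> m_odd [_]; have m_gt0 : 0 < m by case: m m_odd.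
rewrite sigmaM ?expn_gt0 ?coprimeXl ?coprime2n // sigma_pfactor //.
(* The geometric sum [sigma (2 ^ r)] is [(2 ^ r.+1).-1]. *)
by rewrite predn_exp mul1n => ->; rewrite mulnA -expnS subn1.
Qed.

Theorem theorem6 (r b : nat) (hr : 1 <= r) (hb : 1 < b) (hodd : gcdn 2 b = 1)
    (hap : almost_perfect (2 ^ r * b ^ 2)) :
  (r = 1 ->
     ((8 / 7 < abundancy (b ^ 2))%R /\ (abundancy (b ^ 2) < 4 / 3)%R) /\
     ~~ (3 %| b)) /\
  (1 < r ->
     (abundancy (b ^ 2) < 8 / 7)%R /\ ~~ (7 %| b)).
Proof.
have b_odd : odd b by rewrite -coprime2n; apply/eqP.
have n_odd : odd (b ^ 2) by rewrite oddX b_odd orbT.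
have n_ge4 : 4 <= b ^ 2 by rewrite -[4]/(2 ^ 2) leq_sqr.
have n_gt0 : 0 < b ^ 2 by apply: leq_trans n_ge4.
have := almost_perfect_sigma_odd _ _ n_odd hap.
have sigma_ge p : 1 < p -> p %| b -> b ^ 2 + b ^ 2 %/ p <= sigma (b ^ 2).
  by move=> p_gt1 pb; apply: leq_sigma => //; apply: dvdn_mull.
have p_dvd p : p %| b -> p %| b ^ 2 by exact: dvdn_mull.
rewrite abundancy_gt // !abundancy_lt //.
(* From here on only inequalities between [n], [s] and the power of 2 matter. *)
move: (b ^ 2) (sigma _) n_ge4 n_gt0 sigma_ge p_dvd {hap n_odd} => n s.
move=> n_ge4 n_gt0 sigma_ge p_dvd eq_s; split=> [r1 | r_gt1].
  (* Now [3 * s = 4 * n - 1]; the lower bound [8 * n < 7 * s] amounts to [7 < 4 * n], which [n_ge4]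
     gives. *)
  move: eq_s; rewrite r1 => eq_s; split; first by split; lia.
  (* As 3 divides [n], the division is exact and [4 * n <= 3 * s], a contradiction. *)
  by apply/negP => b3; have := sigma_ge 3 isT b3; have := p_dvd 3 b3; lia.
have q_ge8 : 2 ^ 3 <= 2 ^ r.+1 by rewrite leq_exp2l.
have lt_s : 7 * s < 8 * n.
  (* Multiplying the goal by [q - 1] and using [(q - 1) * s = q * n - 1] reduces it to
     [8 * n < q * n + 7]. *)
  by move: (2 ^ r.+1) q_ge8 eq_s => q q_ge8 eq_s; nia.
split=> //; apply/negP => b7.
by have := sigma_ge 7 isT b7; have := p_dvd 7 b7; lia.
Qed.
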